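(* Let $L:C(I)\to GS_2(I,X,\beta)$ be the Lagrange interpolation operator, where $Lf$ is the unique element of $GS_2(I,X,\beta)$ with $Lf(a)=f(a)$, $Lf(b)=f(b)$, and $Lf(m'_i)=f(m'_i)$, $Lf(m''_i)=f(m''_i)$ for $1\le i\le n$. Then $\|L\|_\infty$ is uniformly bounded for all partitions $X$ of $I$. More specifically, setting $\bar\beta=\max\{\beta_i,\ 1\le i\le n\}$, $$\|L\|_\infty\le\frac{4(3\bar\beta-1)}{\bar\beta(5-3\bar\beta)}.$$
   Context: Setting. Let $n\ge 1$, $I=[a,b]$, $X=\{a=x_0<x_1<\dots<x_n=b\}$ a partition of $I$, $I_i=[x_{i-1},x_i]$, $m_i=\frac12(x_{i-1}+x_i)$, and let $m'_i$ and $m''_i$ be the midpoints of $[x_{i-1},m_i]$ and $[m_i,x_i]$ respectively, for $1\le i\le n$. Let $\beta=(\beta_1,\dots,\beta_n)$ with $\beta_i\in[-1,0[$ and $\theta_i=\frac12\frac{\beta_i}{\beta_i-1}\in\,]0,\frac14]$ (equivalently $\beta_i=\frac{-2\theta_i}{1-2\theta_i}$). The space $V(\beta_i)$ (generated by the Merrien subdivision algorithm) is the set of $C^1$ functions $f$ on $I_i$ such that for every dyadic subinterval $[u,v]$ of $I_i$ (i.e. every interval obtained from $I_i$ by repeated bisection, including $I_i$ itself), with $m=\frac12(u+v)$ and $h=v-u$, $$f(m)=\tfrac12\big(f(u)+f(v)-\theta_i h\,(f'(v)-f'(u))\big),\qquad f'(m)=\frac{1}{1-2\theta_i}\Big(\frac{f(v)-f(u)}{h}-2\theta_i\,\frac{f'(u)+f'(v)}{2}\Big).$$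 It is known that for any prescribed values of $f,f'$ at the two endpoints of $I_i$ there is exactly one such $f$; so $\dim V(\beta_i)=4$. $GS_2(\beta)=GS_2(I,X,\beta)$ is the space of all $g\in C^1(I)$ with $g|_{I_i}\in V(\beta_i)$ for all $1\le i\le n$ (generalized quadratic splines); it has dimension $2n+2$. The interpolation problem defining $Lf$ has exactly one solution in $GS_2(I,X,\beta)$ for each $f$. The norm $\|L\|_\infty$ is the operator norm of $L$ on $C(I)$ for the uniform norm. The uniform boundedness means that the stated bound does not depend on the partition $X$ but only on the sequence $\beta$ (through $\bar\beta$). *)

(* Defs.v *)
From mathcomp Require Import all_boot all_order all_algebra.
From mathcomp Require Import all_classical all_reals all_analysis.

Set Implicit Arguments.
Unset Strict Implicit.
Unset Printing Implicit Defensive.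

Import Order.TTheory GRing.Theory Num.Theory.
Import numFieldNormedType.Exports.

Local Open Scope classical_set_scope.
Local Open Scope ring_scope.

(** Functions on an interval are represented by total functions [R -> R] of
    which only the values on the interval are ever used. *)

Definition mid (R : realType) (u v : R) : R := (u + v) / 2.

(** Difference quotients of [f] at [x], taken along the points of [[a, b]] only:
    derivatives at [a] and [b] are one-sided. *)
Definition slopes_in (R : realType) (a b : R) (f : R -> R) (x : R) :=
  (f y - f x) / (y - x) @[y --> within `[a, b] x^'].

Definition deriv_in (R : realType) (a b : R) (f : R -> R) (x : R) : R :=
  lim (slopes_in a b f x).

Definition C0_in (R : realType) (a b : R) (f : R -> R) : Prop :=
  {within `[a, b], continuous f}.

Definition C1_in (R : realType) (a b : R) (f : R -> R) : Prop :=
  (forall x, x \in `[a, b] -> cvg (slopes_in a b f x)) /\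
  C0_in a b (deriv_in a b f).

Inductive dyadic (R : realType) (a b : R) : R -> R -> Prop :=
| dyadic_base : dyadic a b a b
| dyadic_left u v : dyadic a b u v -> dyadic a b u (mid u v)
| dyadic_right u v : dyadic a b u v -> dyadic a b (mid u v) v.

Definition theta (R : realType) (beta : R) : R := 2^-1 * (beta / (beta - 1)).

(** The space generated by the Merrien subdivision algorithm on [[a, b]]. *)
Definition merrien (R : realType) (a b beta : R) (f : R -> R) : Prop :=
  let t := theta beta in
  let f' := deriv_in a b f in
  C1_in a b f /\
  forall u v, dyadic a b u v ->
    f (mid u v) = 2^-1 * (f u + f v - t * (v - u) * (f' v - f' u)) /\
    f' (mid u v) =
      (1 - 2 * t)^-1 * ((f v - f u) / (v - u) - 2 * t * ((f' u + f' v) / 2)).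

(** The partition [a = x_0 < ... < x_n = b] is given by the tuple
    [X = (x_1, ..., x_n)]; the intervals are indexed from 0, so that index
    [i : 'I_n] stands for the interval [[x_i, x_(i+1)]]. *)
Definition knot (R : realType) (a : R) (n : nat) (X : n.-tuple R) (i : nat) : R :=
  nth 0 (a :: X) i.

Definition GS2 (R : realType) (a b : R) (n : nat) (X : n.-tuple R)
    (beta : 'I_n -> R) (g : R -> R) : Prop :=
  C1_in a b g /\
  forall i : 'I_n, merrien (knot a X i) (knot a X i.+1) (beta i) g.

Definition interpolates (R : realType) (a b : R) (n : nat) (X : n.-tuple R)
    (f g : R -> R) : Prop :=
  [/\ g a = f a, g b = f b &
    forall i : 'I_n,
      let u := knot a X i in
      let v := knot a X i.+1 in
      let m := mid u v in
      g (mid u m) = f (mid u m) /\ g (mid m v) = f (mid m v)].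

(** [L] is the Lagrange interpolation operator from [C(I)] to [GS2]; since the
    interpolation problem is uniquely solvable, this determines [L f] on
    [[a, b]] for every [f] in [C(I)]. *)
Definition lagrange_operator (R : realType) (a b : R) (n : nat)
    (X : n.-tuple R) (beta : 'I_n -> R) (L : (R -> R) -> (R -> R)) : Prop :=
  forall f, C0_in a b f -> GS2 a b X beta (L f) /\ interpolates a b X f (L f).

(** Both norms take values in [\bar R], so that they are genuine suprema even
    before they are known to be finite. *)
Definition unif_norm (R : realType) (a b : R) (f : R -> R) : \bar R :=
  ereal_sup [set (`|f x|)%:E | x in `[a, b]].

Definition op_norm (R : realType) (a b : R) (L : (R -> R) -> (R -> R)) : \bar R :=
  ereal_sup [set unif_norm a b (L f) |
    f in [set f | C0_in a b f /\ (unif_norm a b f <= 1)%E]].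

(** As every [beta i] is at least [-1], starting the maximum at [-1] is
    harmless when [0 < n]. *)
Definition beta_max (R : realType) (n : nat) (beta : 'I_n -> R) : R :=
  \big[Num.max/-1]_(i < n) beta i.

(* Main.v *)
Require Import Defs.
From mathcomp Require Import all_boot all_order all_algebra.
From mathcomp Require Import all_classical all_reals all_analysis.
From mathcomp Require Import ring lra.

Set Implicit Arguments.
Unset Strict Implicit.
Unset Printing Implicit Defensive.

Import Order.TTheory GRing.Theory Num.Theory.
Import numFieldNormedType.Exports.
Local Open Scope ring_scope.

(** On an interval [[u, v]] of length [h], an element [g] of the Merrien space
    is governed by four control ordinates
      [A0 = g u], [A1 = g u + t h g' u], [A2 = g v - t h g' v], [A3 = g v],
    where [t = theta beta]. In these terms the subdivision rule becomes corner
    cutting: the control ordinates of the two halves are convex combinations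
    of those of [[u, v]] ([ctrl_left_half], [ctrl_right_half]). Hence a bound on
    the control ordinates propagates to all dyadic points, and by continuity
    to the whole interval ([merrien_sup_le]).

    Put [w = - beta] and let [y], [z] be the data at the two quarter points of
    an interval. Interpolation reads
      [2 A0 + (4 + w) A1 + (2 - w) A2 = 8 y],
      [2 A3 + (4 + w) A2 + (2 - w) A1 = 8 z]
    ([quarter_values]), so that [A1] and [A2] are explicit in the knot values
    [A0], [A3] and in the data.

    The knot values are bounded by a maximum principle ([knot_values_le]).
    Suppose that [|f| <= 1] and that the largest knot value [|c|] is attained at
    an interior knot, with, say, [c > 0]. If [c > 3 / (1 + w)] on both sides, the
    formulas for the inner control ordinates next to the knot force both of
    them below [c]: the derivative at the knot is negative according to the
    right-hand interval and positive according to the left-hand one, which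
    contradicts the continuity of the derivative. Thus every knot value is at
    most [C = 3 / (1 - B)], where [B] is the largest of the [beta i]. No length
    of a partition interval enters this bound.

    The inner control ordinates of a partition interval themselves are too
    large for the required constant, but after one subdivision they are at most
    [max(C, 4/3 + C/3)] ([first_half_ctrl_le]). This is a bound for the norm of
    the interpolation operator, and it does not exceed the announced constant
    ([lagrange_bound_ge]). *)

(** * Control ordinates and corner cutting *)

(** The two Merrien equations on [[u, v]], with the derivative as a separate
    function: a spline obeys them on every partition interval with one and the
    same [g'], whereas [merrien] refers to a one-sided derivative of its own on
    each interval. *)
Definition merrien_rule (R : realType) (beta : R) (g g' : R -> R) (u v : R) :=
  let t := theta beta in
  g (mid u v) = 2^-1 * (g u + g v - t * (v - u) * (g' v - g' u)) /\
  g' (mid u v) =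
    (1 - 2 * t)^-1 * ((g v - g u) / (v - u) - 2 * t * ((g' u + g' v) / 2)).

Definition ctrl_left (R : realType) (beta : R) (g g' : R -> R) (u v : R) : R :=
  g u + theta beta * (v - u) * g' u.

Definition ctrl_right (R : realType) (beta : R) (g g' : R -> R) (u v : R) : R :=
  g v - theta beta * (v - u) * g' v.

Definition ctrl_le (R : realType) (beta : R) (g g' : R -> R) (K u v : R) :=
  [/\ `|g u| <= K, `|ctrl_left beta g g' u v| <= K,
      `|ctrl_right beta g g' u v| <= K & `|g v| <= K].

Lemma theta_gt0 (R : realType) (beta : R) : beta < 0 -> 0 < theta beta.
Proof.
move=> b0; rewrite /theta mulr_gt0 ?invr_gt0//.
by rewrite nmulr_lgt0 // invr_lt0; lra.
Qed.

(** The rule for [g] only involves the two inner ordinates. So does the rule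
    for [g'], because [theta * (1 - 2 * theta)^-1 = - beta / 2]. *)
Lemma merrien_ruleE (R : realType) (beta : R) (g g' : R -> R) (u v : R) :
  beta < 0 -> u < v -> merrien_rule beta g g' u v ->
  let A1 := ctrl_left beta g g' u v in
  let A2 := ctrl_right beta g g' u v in
  g (mid u v) = (A1 + A2) / 2 /\
  theta beta * (v - u) * g' (mid u v) = - beta / 2 * (A2 - A1).
Proof.
move=> b0 uv [gm gm']; rewrite /= gm gm' /ctrl_left /ctrl_right /theta.
by split; field; do ?[apply/andP; split]; apply/negP => /eqP; lra.
Qed.

(** Corner cutting: the weights [2^-1 - beta / 4] and [2^-1 + beta / 4] are
    nonnegative for [-2 <= beta <= 2] and add up to [1]. *)
Lemma ctrl_left_half (R : realType) (beta : R) (g g' : R -> R) (u v : R) :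
  beta < 0 -> u < v -> merrien_rule beta g g' u v ->
  let A1 := ctrl_left beta g g' u v in
  let A2 := ctrl_right beta g g' u v in
  ctrl_left beta g g' u (mid u v) = (g u + A1) / 2 /\
  ctrl_right beta g g' u (mid u v) =
    (2^-1 - beta / 4) * A1 + (2^-1 + beta / 4) * A2.
Proof.
move=> b0 uv /(merrien_ruleE b0 uv) /= [gm gm'].
have e : mid u v - u = (v - u) / 2 by rewrite /mid; field.
split; first by rewrite /ctrl_left e; field.
by rewrite [in LHS]/ctrl_right gm e mulrA mulrAC gm'; field.
Qed.

Lemma ctrl_right_half (R : realType) (beta : R) (g g' : R -> R) (u v : R) :
  beta < 0 -> u < v -> merrien_rule beta g g' u v ->
  let A1 := ctrl_left beta g g' u v in
  let A2 := ctrl_right beta g g' u v in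
  ctrl_left beta g g' (mid u v) v =
    (2^-1 + beta / 4) * A1 + (2^-1 - beta / 4) * A2 /\
  ctrl_right beta g g' (mid u v) v = (A2 + g v) / 2.
Proof.
move=> b0 uv /(merrien_ruleE b0 uv) /= [gm gm'].
have e : v - mid u v = (v - u) / 2 by rewrite /mid; field.
split; last by rewrite /ctrl_right e; field.
by rewrite [in LHS]/ctrl_left gm e mulrA mulrAC gm'; field.
Qed.

Lemma norm_convex_le (R : realType) (s t K x y : R) :
  0 <= s -> 0 <= t -> s + t = 1 -> `|x| <= K -> `|y| <= K ->
  `|s * x + t * y| <= K.
Proof.
move=> s0 t0 st xK yK; rewrite (le_trans (ler_normD _ _))// !normrM.
rewrite (ger0_norm s0) (ger0_norm t0) -[leRHS]mul1r -st mulrDl.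
by rewrite lerD// ler_wpM2l.
Qed.

Lemma ctrl_le_half (R : realType) (beta : R) (g g' : R -> R) (K u v : R) :
  -1 <= beta < 0 -> u < v -> merrien_rule beta g g' u v ->
  ctrl_le beta g g' K u v ->
  ctrl_le beta g g' K u (mid u v) /\ ctrl_le beta g g' K (mid u v) v.
Proof.
move=> /andP[b1 b0] uv rule [gu A1 A2 gv].
have [gm _] := merrien_ruleE b0 uv rule.
have [e1 e2] := ctrl_left_half b0 uv rule.
have [e3 e4] := ctrl_right_half b0 uv rule.
have half x y : `|x| <= K -> `|y| <= K -> `|(x + y) / 2| <= K.
  move=> xK yK; have -> : (x + y) / 2 = 2^-1 * x + 2^-1 * y by field.
  by apply: norm_convex_le => //; lra.
by split; split => //; rewrite ?gm ?e1 ?e2 ?e3 ?e4; try exact: half;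
  apply: norm_convex_le => //; lra.
Qed.

(** * The interpolation conditions on one interval *)

(** The interpolation conditions at the two quarter points of an interval with
    control ordinates [c0], [A1], [A2], [c3], where [w] stands for [- beta]. *)
Definition quarter_data (R : realType) (w c0 A1 A2 c3 y z : R) :=
  2 * c0 + (4 + w) * A1 + (2 - w) * A2 = 8 * y /\
  2 * c3 + (4 + w) * A2 + (2 - w) * A1 = 8 * z.

(** Reflection of the interval: it exchanges the roles of its two endpoints,
    so that only left endpoints need to be studied. *)
Lemma quarter_dataC (R : realType) (w c0 A1 A2 c3 y z : R) :
  quarter_data w c0 A1 A2 c3 y z -> quarter_data w c3 A2 A1 c0 z y.
Proof. by case=> h1 h2; split. Qed.

Lemma quarter_dataN (R : realType) (w c0 A1 A2 c3 y z : R) :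
  quarter_data w c0 A1 A2 c3 y z ->
  quarter_data w (- c0) (- A1) (- A2) (- c3) (- y) (- z).
Proof. by case=> h1 h2; split; [rewrite !mulrN -h1|rewrite !mulrN -h2]; ring. Qed.

Lemma quarter_values (R : realType) (beta : R) (g g' : R -> R) (u v : R) :
  beta < 0 -> u < v -> merrien_rule beta g g' u v ->
  merrien_rule beta g g' u (mid u v) -> merrien_rule beta g g' (mid u v) v ->
  quarter_data (- beta) (g u) (ctrl_left beta g g' u v)
    (ctrl_right beta g g' u v) (g v)
    (g (mid u (mid u v))) (g (mid (mid u v) v)).
Proof.
move=> b0 uv r rl rr.
have um : u < mid u v by rewrite /mid; lra.
have mv : mid u v < v by rewrite /mid; lra.
have [-> _] := merrien_ruleE b0 um rl.
have [-> _] := merrien_ruleE b0 mv rr.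
have [-> ->] := ctrl_left_half b0 uv r.
have [-> ->] := ctrl_right_half b0 uv r.
by split; field.
Qed.

(** Elimination of [A2]: the determinant of the system in [A1], [A2] is
    [(4 + w)^2 - (2 - w)^2 = 12 (1 + w)]. *)
Lemma quarter_data_ctrl_left (R : realType) (w c0 A1 A2 c3 y z : R) :
  quarter_data w c0 A1 A2 c3 y z ->
  6 * (1 + w) * A1 = 4 * (4 + w) * y - 4 * (2 - w) * z - (4 + w) * c0 + (2 - w) * c3.
Proof.
move=> [h1 h2].
have e1 : 4 * y = c0 + (4 + w) / 2 * A1 + (2 - w) / 2 * A2.
  by apply: (@mulfI _ 2) => //; rewrite mulrA -natrM -h1; field.
have e2 : 4 * z = c3 + (4 + w) / 2 * A2 + (2 - w) / 2 * A1.
  by apply: (@mulfI _ 2) => //; rewrite mulrA -natrM -h2; field.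
by rewrite [4 * _ * y]mulrAC [4 * _ * z]mulrAC e1 e2; field.
Qed.

(** In the formula for [6 (1 + w) A1] the data contribute at most
    [4 (4 + w) + 4 (2 - w) = 24] and the knot values at most
    [(2 - w) c0 - (4 + w) c0 = - 2 (1 + w) c0]; the sum is smaller than
    [6 (1 + w) c0] as soon as [(1 + w) c0 > 3]. *)
Lemma ctrl_left_lt_knot (R : realType) (w c0 A1 A2 c3 y z : R) :
  0 < w <= 1 -> quarter_data w c0 A1 A2 c3 y z ->
  `|y| <= 1 -> `|z| <= 1 -> `|c3| <= c0 -> 3 < (1 + w) * c0 -> A1 < c0.
Proof.
move=> /andP[w0 w1] /quarter_data_ctrl_left q.
rewrite !ler_norml => /andP[y1 y2] /andP[z1 z2] /andP[c1 c2] big.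
rewrite -(ltr_pM2l (_ : 0 < 6 * (1 + w))); last by lra.
rewrite q.
have hy : (4 + w) * y <= 4 + w by rewrite ler_piMr//; lra.
have hz : - ((2 - w) * z) <= 2 - w by rewrite -mulrN ler_piMr//; lra.
have hc : (2 - w) * c3 <= (2 - w) * c0 by rewrite ler_wpM2l//; lra.
lra.
Qed.

(** The three quantities are the control ordinates of the left half other
    than [c0]. Once expressed in [c0], [c3], [y], [z], all their coefficients
    have a known sign for [0 < w <= 1], and the bounds add up the moduli of the
    coefficients. Bounding [A1] and [A2] first would lose this cancellation:
    for [w = 1] and [C = 3 / 2] the best bound for [|A1|] is [11 / 4], but the
    bounds obtained here are at most [11 / 6]. *)
Lemma first_half_ctrl_le (R : realType) (w c0 A1 A2 c3 y z C : R) :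
  0 < w <= 1 -> quarter_data w c0 A1 A2 c3 y z ->
  `|y| <= 1 -> `|z| <= 1 -> `|c0| <= C -> `|c3| <= C -> 3 <= (1 + w) * C ->
  [/\ `|(c0 + A1) / 2| <= C,
      `|(2^-1 + w / 4) * A1 + (2^-1 - w / 4) * A2| <= 4 / 3 + C / 3 &
      `|(A1 + A2) / 2| <= 4 / 3 + C / 3].
Proof.
move=> /andP[w0 w1] q hy hz h0 h3 big.
have e1 := quarter_data_ctrl_left q.
have e2 := quarter_data_ctrl_left (quarter_dataC q).
have scaled (D X K : R) : 0 < D -> `|D * X| <= D * K -> `|X| <= K.
  by move=> D0; rewrite normrM (gtr0_norm D0) ler_pM2l.
have term (k x b : R) : 0 <= k -> `|x| <= b -> - (k * b) <= k * x <= k * b.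
  by move=> k0; rewrite -ler_norml normrM (ger0_norm k0) => /(ler_wpM2l k0).
have k1 : 0 <= 2 - w by lra.
have k2 : 0 <= 4 + w by lra.
have k3 : 0 <= 2 + 5 * w by lra.
have /andP[? ?] := term _ _ _ k1 hy; have /andP[? ?] := term _ _ _ k1 hz.
have /andP[? ?] := term _ _ _ k1 h0; have /andP[? ?] := term _ _ _ k1 h3.
have /andP[? ?] := term _ _ _ k2 hy; have /andP[? ?] := term _ _ _ k2 hz.
have /andP[? ?] := term _ _ _ k3 hy; have /andP[? ?] := term _ _ _ k3 h0.
split.
- apply: (@scaled (12 * (1 + w))); first lra.
  have -> : 12 * (1 + w) * ((c0 + A1) / 2) =
      6 * (1 + w) * c0 + 6 * (1 + w) * A1 by field.
  by rewrite e1 ler_norml; apply/andP; split; lra.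
- apply: (@scaled (3 * (1 + w))); first lra.
  have -> : 3 * (1 + w) * ((2^-1 + w / 4) * A1 + (2^-1 - w / 4) * A2) =
      (2^-1 + w / 4) / 2 * (6 * (1 + w) * A1) +
      (2^-1 - w / 4) / 2 * (6 * (1 + w) * A2) by field.
  have -> : (2^-1 + w / 4) / 2 * (6 * (1 + w) * A1) +
      (2^-1 - w / 4) / 2 * (6 * (1 + w) * A2) =
      (2 + 5 * w) * y - (2 + 5 * w) * c0 / 4 + (2 - w) * z - (2 - w) * c3 / 4.
    by rewrite e1 e2; field.
  by rewrite ler_norml; apply/andP; split; lra.
- case: q => q1 q2.
  move: hy hz h0 h3; rewrite !ler_norml.
  move=> /andP[? ?] /andP[? ?] /andP[? ?] /andP[? ?].
  by apply/andP; split; lra.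
Qed.

(** Sign-free form of [ctrl_left_lt_knot]. As [A1 - c0] is a positive multiple
    of the derivative at the knot, it says that [|g|] strictly decreases when
    one enters the interval from a knot with a large value of maximal modulus. *)
Lemma knot_slope_sign (R : realType) (w c0 A1 A2 c3 y z : R) :
  0 < w <= 1 -> quarter_data w c0 A1 A2 c3 y z ->
  `|y| <= 1 -> `|z| <= 1 -> `|c3| <= `|c0| -> 3 < (1 + w) * `|c0| ->
  c0 * (A1 - c0) < 0.
Proof.
move=> w01 q hy hz; case: (ltrP 0 c0) => [c0p|c0n] h3 big.
  rewrite (gtr0_norm c0p) in h3 big.
  by rewrite pmulr_rlt0// subr_lt0 (ctrl_left_lt_knot w01 q).
have c0lt0 : c0 < 0.
  rewrite lt_neqAle c0n andbT; apply/eqP => c00.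
  by move: big; rewrite c00 normr0 mulr0; lra.
rewrite (ltr0_norm c0lt0) in h3 big.
rewrite nmulr_rlt0// subr_gt0 -ltrN2.
by apply: (ctrl_left_lt_knot w01 (quarter_dataN q)); rewrite ?normrN.
Qed.

(** * Dyadic intervals and one-sided derivatives *)

Lemma dyadic_sub (R : realType) (a b u v : R) :
  a < b -> dyadic a b u v -> [/\ a <= u, u < v & v <= b].
Proof.
move=> ab; elim=> [|{}u {}v _ [au uv vb]|{}u {}v _ [au uv vb]]; first by split.
- by split; rewrite /mid; lra.
- by split; rewrite /mid; lra.
Qed.

Lemma dyadic_cover (R : realType) (a b x : R) (k : nat) :
  a <= x <= b -> exists c d,
    [/\ dyadic a b c d, c <= x <= d & d - c = (b - a) / 2 ^+ k].
Proof.
move=> xab; elim: k => [|k [c [d [cd /andP[cx xd] e]]]].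
  by exists a, b; split => //; [exact: dyadic_base | rewrite expr0 divr1].
have e2 : (b - a) / 2 ^+ k.+1 = (d - c) / 2.
  by rewrite e exprS invfM; ring.
have [xm|mx] := lerP x (mid c d).
- exists c, (mid c d); split; [exact: dyadic_left|by rewrite cx|].
  by rewrite e2 /mid; field.
- exists (mid c d), d; split; [exact: dyadic_right|by rewrite xd ltW|].
  by rewrite e2 /mid; field.
Qed.

Local Open Scope classical_set_scope.

(** Dyadic points accumulate at [x] along the punctured neighbourhoods of [x]
    in [[a, b]]: of the two endpoints of a short dyadic interval around [x], at
    least one differs from [x]. *)
Lemma dyadic_endpoint_near (R : realType) (a b x : R) (P : set R) :
  a < b -> a <= x <= b -> (\forall y \near within `[a, b] x^', P y) ->
  exists c d, [/\ dyadic a b c d, c <= x <= d & P c \/ P d].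
Proof.
move=> ab xab; rewrite near_withinE /dnbhs near_withinE.
move=> /nbhs_ballP[e /= e0 eP].
have ba0 : 0 < b - a by rewrite subr_gt0.
have [k ek] : exists k, (b - a) / 2 ^+ k < e.
  have r0 : 0 < e / (b - a) by rewrite divr_gt0.
  have [k _ kP] := near_infty_natSinv_expn_lt (PosNum r0).
  exists k; have := kP k (leqnn k).
  by rewrite /= div1r ltr_pdivlMr// mulrC.
have [c [d [cd /andP[cx xd] dc]]] := dyadic_cover k xab.
have [ac cltd db] := dyadic_sub ab cd.
exists c, d; split => //; first by rewrite cx.
rewrite -dc in ek.
have [cx'|xc] := ltrP c x; [left|right]; apply: eP.
- by rewrite /ball/= ger0_norm; lra.
- by rewrite lt_eqF.
- by rewrite /= in_itv/=; lra.
- by rewrite /ball/= ler0_norm; lra.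
- by rewrite gt_eqF//; lra.
- by rewrite /= in_itv/=; lra.
Qed.

Lemma within_itv_dnbhs_proper (R : realType) (a b x : R) :
  a < b -> a <= x <= b -> ProperFilter (within `[a, b] x^').
Proof.
move=> ab xab; apply: Build_ProperFilter_ex => P.
by case/(dyadic_endpoint_near ab xab) => c [d [_ _ [Pc|Pd]]]; [exists c|exists d].
Qed.

(** A limit along [[a, b]] is inherited by [[u, v]], whose trace filter is
    finer; in particular the derivatives of a spline taken from either side of
    a knot agree with its derivative on the whole interval. *)
Lemma deriv_in_sub (R : realType) (a b u v x : R) (g : R -> R) :
  a <= u -> v <= b -> u < v -> u <= x <= v -> cvg (slopes_in a b g x) ->
  deriv_in u v g x = deriv_in a b g x.
Proof.
move=> au vb uv xuv g_ab.
have pf := within_itv_dnbhs_proper uv xuv.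
apply: (@cvg_lim _ (@Rhausdorff R)).
apply: cvg_trans g_ab; apply: cvg_app; apply: within_subset.
by move=> y /=; rewrite !in_itv/= => /andP[uy yv]; apply/andP; lra.
Qed.

Lemma slopes_in_continuous (R : realType) (a b x : R) (g : R -> R) :
  cvg (slopes_in a b g x) -> g y @[y --> within `[a, b] x^'] --> g x.
Proof.
move=> /cvg_ex[l gl].
have idx : y - x @[y --> within `[a, b] x^'] --> (0 : R).
  rewrite -(subrr x); apply: cvgB; last exact: cvg_cst.
  by move=> A /nbhs_dnbhs; apply: cvg_within.
have lin : (g y - g x) / (y - x) * (y - x) + g x @[y --> within `[a, b] x^']
    --> l * 0 + g x.
  by apply: cvgD; [exact: cvgM|exact: cvg_cst].
rewrite mulr0 add0r in lin; apply: cvg_trans lin; apply: near_eq_cvg.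
rewrite near_withinE /dnbhs near_withinE.
by near=> y => /= yx _; rewrite divfK ?subrK// subr_eq0.
Unshelve. all: by end_near. Qed.

Lemma dyadic_sup_le (R : realType) (a b K : R) (g : R -> R) :
  a < b -> (forall x, a <= x <= b -> cvg (slopes_in a b g x)) ->
  (forall c d, dyadic a b c d -> `|g c| <= K /\ `|g d| <= K) ->
  forall x, a <= x <= b -> `|g x| <= K.
Proof.
move=> ab g_diff gK x xab; rewrite leNgt; apply/negP => Kx.
have cg : `|g y| @[y --> within `[a, b] x^'] --> `|g x|.
  by apply: cvg_norm; exact: slopes_in_continuous (g_diff _ xab).
have [c [d [/gK[gc gd] _ cP]]] :=
  dyadic_endpoint_near ab xab (cvgr_gt _ cg _ Kx).
by case: cP => /=; rewrite ltNge ?gc ?gd.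
Qed.

Lemma merrien_rule_sub (R : realType) (a b u v beta : R) (g : R -> R) :
  a <= u -> v <= b -> u < v -> C1_in a b g -> merrien u v beta g ->
  forall c d, dyadic u v c d -> merrien_rule beta g (deriv_in a b g) c d.
Proof.
move=> au vb uv [g_diff _] [_ rule] c d cd; have [uc cltd dv] := dyadic_sub uv cd.
have e x : c <= x <= d -> deriv_in u v g x = deriv_in a b g x.
  move=> /andP[cx xd]; apply: deriv_in_sub => //; first lra.
  by apply: g_diff; rewrite in_itv/=; lra.
have [] := rule _ _ cd; rewrite /merrien_rule !e //; rewrite /mid; lra.
Qed.

(** The control ordinates are only assumed bounded after the first
    bisection, so [[u, v]] itself is an exception in the induction over dyadic
    intervals; its endpoints are also endpoints of the halves. *)
Lemma merrien_sup_le (R : realType) (u v beta K : R) (g g' : R -> R) :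
  -1 <= beta < 0 -> u < v ->
  (forall x, u <= x <= v -> cvg (slopes_in u v g x)) ->
  (forall c d, dyadic u v c d -> merrien_rule beta g g' c d) ->
  ctrl_le beta g g' K u (mid u v) -> ctrl_le beta g g' K (mid u v) v ->
  forall x, u <= x <= v -> `|g x| <= K.
Proof.
move=> hb uv g_diff rule hl hr; apply: dyadic_sup_le => // c d.
suff H : dyadic u v c d -> (c = u /\ d = v) \/ ctrl_le beta g g' K c d.
  case/H => [[-> ->]|[? _ _ ?]] //.
  by case: hl hr => [? _ _ _] [_ _ _ ?].
elim=> [|{}c {}d cd [[-> ->]|h]|{}c {}d cd [[-> ->]|h]]; first by left.
- by right.
- have [_ cltd _] := dyadic_sub uv cd.
  by right; case: (ctrl_le_half hb cltd (rule _ _ cd) h).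
- by right.
- have [_ cltd _] := dyadic_sub uv cd.
  by right; case: (ctrl_le_half hb cltd (rule _ _ cd) h).
Qed.

Local Close Scope classical_set_scope.

(** * Interpolating splines *)

Lemma knot_lt (R : realType) (a b : R) (n : nat) (X : n.-tuple R) (i : nat) :
  itv_partition a b X -> (i < n)%N -> knot a X i < knot a X i.+1.
Proof. by move=> [/(pathP 0) + _] i_n; apply; rewrite size_tuple. Qed.

Lemma knot_last (R : realType) (a b : R) (n : nat) (X : n.-tuple R) :
  itv_partition a b X -> knot a X n = b.
Proof. by move=> /(itv_partition_nth_size 0); rewrite size_tuple. Qed.

Lemma knot_itv (R : realType) (a b : R) (n : nat) (X : n.-tuple R) (i : nat) :
  itv_partition a b X -> (i <= n)%N -> a <= knot a X i <= b.
Proof.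
move=> abX i_n; have iX : (i < (size X).+1)%N by rewrite size_tuple ltnS.
have <- : nth b (a :: X) i = knot a X i by apply: set_nth_default.
by rewrite itv_partition_nth_ge// itv_partition_nth_le.
Qed.

Lemma knot_cover (R : realType) (a b x : R) (n : nat) (X : n.-tuple R) :
  (0 < n)%N -> itv_partition a b X -> a <= x <= b ->
  exists i : 'I_n, knot a X i <= x <= knot a X i.+1.
Proof.
move=> n0 abX /andP[ax xb].
have ex : exists i, (0 < i)%N && (x <= knot a X i).
  by exists n; rewrite n0 (knot_last abX).
(* The interval sought ends at the first knot after [a] to the right of [x]. *)
case: (ex_minnP ex) => -[//|i] /= xi imin.
have i_n : (i < n)%N by apply: imin; rewrite n0 (knot_last abX).
exists (Ordinal i_n); rewrite /= xi andbT; case: i i_n imin {xi} => [//|i] _ imin.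
rewrite leNgt; apply/negP => xi; have := imin i.+1.
by rewrite /= ltnn (ltW xi) => /(_ isT).
Qed.

(** Maximum principle for the knot values: the two intervals that meet at a
    knot share the value of [g'] there, and [knot_slope_sign] gives it opposite
    signs on the two sides of a knot where [|g|] is maximal and exceeds [C]. *)
Lemma knot_values_le (R : realType) (n : nat) (x : nat -> R) (beta : 'I_n -> R)
    (g g' : R -> R) (y z : 'I_n -> R) (C : R) :
  (forall i : 'I_n, -1 <= beta i < 0) -> (forall i : 'I_n, x i < x i.+1) ->
  (forall i : 'I_n, quarter_data (- beta i) (g (x i))
     (ctrl_left (beta i) g g' (x i) (x i.+1))
     (ctrl_right (beta i) g g' (x i) (x i.+1)) (g (x i.+1)) (y i) (z i)) ->
  (forall i : 'I_n, `|y i| <= 1 /\ `|z i| <= 1) ->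
  `|g (x 0%N)| <= 1 -> `|g (x n)| <= 1 ->
  1 <= C -> (forall i : 'I_n, 3 <= (1 - beta i) * C) ->
  forall i : nat, (i <= n)%N -> `|g (x i)| <= C.
Proof.
move=> hb xlt q hyz g0 gn C1 C3 i i_n.
(* [j] is a knot at which the largest modulus is attained. *)
case: (@arg_maxP _ _ 'I_n.+1 ord0 xpredT (fun j : 'I_n.+1 => `|g (x j)|)) => //.
move=> j _ jmax.
have {}jmax k : (k <= n)%N -> `|g (x k)| <= `|g (x j)|.
  by move=> k_n; apply: (jmax (Ordinal (k_n : (k < n.+1)%N))).
apply: le_trans (jmax _ i_n) _.
rewrite leNgt; apply/negP => Cj.
case: j => -[|k] /= k_n in jmax Cj *; first lra.
have kn : (k < n)%N by rewrite -ltnS.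
have [kn'|] := ltnP k.+1 n; last first.
  move=> nk; have kE : k.+1 = n by apply/eqP; rewrite eqn_leq nk andbT -ltnS.
  by rewrite kE in Cj; lra.
(* The interior knot [k.+1] ends the interval [k] and starts the interval
   [k.+1]; the two intervals give opposite signs to [g'] there. *)
have big l : 3 < (1 + - beta l) * `|g (x k.+1)|.
  by apply: le_lt_trans (C3 l) _; rewrite ltr_pM2l//; case/andP: (hb l); lra.
have w01 l : 0 < - beta l <= 1 by case/andP: (hb l) => ? ?; apply/andP; lra.
have xk := xlt (Ordinal kn); have xk1 := xlt (Ordinal kn').
rewrite /= in xk xk1.
have := knot_slope_sign (w01 _) (q (Ordinal kn')) (hyz _).1 (hyz _).2
  (jmax _ kn') (big _).
have := knot_slope_sign (w01 _) (quarter_dataC (q (Ordinal kn))) (hyz _).2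
  (hyz _).1 (jmax _ (ltnW kn)) (big _).
rewrite /ctrl_left /ctrl_right /=.
have -> (c e : R) : c - e - c = - e by ring.
have -> (c e : R) : c + e - c = e by ring.
have step_gt0 (l : 'I_n) : 0 < theta (beta l) * (x l.+1 - x l).
  by rewrite mulr_gt0 ?subr_gt0// theta_gt0//; case/andP: (hb l).
have /= t1 := step_gt0 (Ordinal kn); have /= t2 := step_gt0 (Ordinal kn').
rewrite mulrN oppr_lt0 !(mulrCA (g (x k.+1))) (pmulr_rgt0 _ t1) (pmulr_rlt0 _ t2).
by move=> /lt_trans h /h; rewrite ltxx.
Qed.

Lemma GS2_sup_le (R : realType) (a b : R) (n : nat) (X : n.-tuple R)
    (beta : 'I_n -> R) (f g : R -> R) (C K : R) :
  (0 < n)%N -> (forall i, -1 <= beta i < 0) -> itv_partition a b X ->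
  GS2 a b X beta g -> interpolates a b X f g ->
  (forall x, a <= x <= b -> `|f x| <= 1) ->
  1 <= C -> (forall i, 3 <= (1 - beta i) * C) -> C <= K -> 4 / 3 + C / 3 <= K ->
  forall x, a <= x <= b -> `|g x| <= K.
Proof.
move=> n0 hb abX [gC1 gM] [ga gb gf] f1 C1 C3 CK CK' x xab.
pose g' := deriv_in a b g.
have klt (i : 'I_n) : knot a X i < knot a X i.+1 by apply: (knot_lt abX).
have ak (i : 'I_n) : a <= knot a X i.
  by case/andP: (knot_itv abX (ltnW (ltn_ord i))).
have kb (i : 'I_n) : knot a X i.+1 <= b by case/andP: (knot_itv abX (ltn_ord i)).
have ab : a < b.
  by have := klt (Ordinal n0); have := ak (Ordinal n0); have := kb (Ordinal n0); lra.
have rule i := merrien_rule_sub (ak i) (kb i) (klt i) gC1 (gM i).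
pose y i := g (mid (knot a X i) (mid (knot a X i) (knot a X i.+1))).
pose z i := g (mid (mid (knot a X i) (knot a X i.+1)) (knot a X i.+1)).
have q (i : 'I_n) : quarter_data (- beta i) (g (knot a X i))
     (ctrl_left (beta i) g g' (knot a X i) (knot a X i.+1))
     (ctrl_right (beta i) g g' (knot a X i) (knot a X i.+1)) (g (knot a X i.+1))
     (y i) (z i).
  apply: quarter_values => //; first by case/andP: (hb i).
  - by apply: rule; exact: dyadic_base.
  - by apply: rule; apply: dyadic_left; exact: dyadic_base.
  - by apply: rule; apply: dyadic_right; exact: dyadic_base.
have yz1 (i : 'I_n) : `|y i| <= 1 /\ `|z i| <= 1.
  rewrite /y /z; have [-> ->] := gf i.
  by have := klt i; have := ak i; have := kb i; split; apply: f1; rewrite /mid; lra.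
have kC : forall i, (i <= n)%N -> `|g (knot a X i)| <= C.
  apply: (knot_values_le hb klt q yz1) => //.
    by rewrite [knot a X 0]/= ga f1//; lra.
  by rewrite (knot_last abX) gb f1//; lra.
have [i xi] := knot_cover n0 abX xab.
have w01 : 0 < - beta i <= 1 by case/andP: (hb i) => ? ?; apply/andP; lra.
have c0 := kC _ (ltnW (ltn_ord i)); have c3 := kC _ (ltn_ord i).
have ruleb := rule i _ _ (dyadic_base _ _).
have b0 : beta i < 0 by case/andP: (hb i).
have [l1 l2 l3] := first_half_ctrl_le w01 (q i) (yz1 i).1 (yz1 i).2 c0 c3 (C3 i).
have [r1 r2 _] := first_half_ctrl_le w01 (quarter_dataC (q i)) (yz1 i).2 (yz1 i).1 c3 c0 (C3 i).
have [e _] := merrien_ruleE b0 (klt i) ruleb.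
have [e1 e2] := ctrl_left_half b0 (klt i) ruleb.
have [e3 e4] := ctrl_right_half b0 (klt i) ruleb.
apply: (merrien_sup_le (hb i) (klt i) _ (rule i) _ _ xi).
- by move=> t ti; apply: (gM i).1.1; rewrite in_itv.
- split; rewrite ?e ?e1 ?e2.
  + exact: le_trans c0 CK.
  + exact: le_trans l1 CK.
  + by move: l2; rewrite !mulNr opprK => /le_trans; apply.
  + exact: le_trans l3 CK'.
- split; rewrite ?e ?e3 ?e4.
  + exact: le_trans l3 CK'.
  + by rewrite addrC; move: r2; rewrite !mulNr opprK => /le_trans; apply.
  + by apply: le_trans CK; rewrite addrC.
  + exact: le_trans c3 CK.
Qed.

(** With [W = - B], clearing the positive denominators reduces the last two
    inequalities to [0 <= 3 W^2 + W + 4] and [12 W^3 + 5 W^2 <= 13 W + 12], true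
    for [0 < W <= 1]. *)
Lemma lagrange_bound_ge (R : realType) (B : R) : -1 <= B < 0 ->
  let C := 3 / (1 - B) in
  let K := 4 * (3 * B - 1) / (B * (5 - 3 * B)) in
  [/\ 1 <= C, C <= K & 4 / 3 + C / 3 <= K].
Proof.
move=> /andP[B1 B0] C K.
have s0 : 0 < 1 - B by lra.
have D0 : 0 < - B * (5 - 3 * B) by rewrite mulr_gt0//; lra.
have KE : K = 4 * (1 - 3 * B) / (- B * (5 - 3 * B)).
  by rewrite /K; field; apply/andP; split; apply/negP => /eqP; lra.
have CE : C * (1 - B) = 3 by rewrite /C divfK// gt_eqF.
have scale r : r * (1 - B) * (- B * (5 - 3 * B)) <=
    4 * (1 - 3 * B) * (1 - B) -> r <= K.
  by rewrite KE ler_pdivlMr// => h; rewrite -(ler_pM2r s0) mulrAC.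
split; first by rewrite /C ler_pdivlMr//; lra.
- by apply: scale; rewrite CE; nra.
- apply: scale; have -> : (4 / 3 + C / 3) * (1 - B) = (7 - 4 * B) / 3.
    by rewrite mulrDl [C / 3 * _]mulrAC CE; field.
  by nra.
Qed.

Lemma le_unif_norm (R : realType) (a b K : R) (f : R -> R) :
  (unif_norm a b f <= K%:E)%E <-> forall x, a <= x <= b -> `|f x| <= K.
Proof.
split=> [fK x xab|fK].
  rewrite -lee_fin; apply: le_trans fK; apply: ereal_sup_ubound.
  by exists x => //=; rewrite in_itv.
apply: ge_ereal_sup => _ [x /= xab <-].
by rewrite lee_fin; apply: fK; rewrite in_itv in xab.
Qed.

Unset Implicit Arguments.

Theorem theorem11 (R : realType) (a b : R) (n : nat) (n_gt0 : (0 < n)%N)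
    (beta : 'I_n -> R) (beta_itv : forall i : 'I_n, -1 <= beta i < 0) :
  (exists M : R, forall (X : n.-tuple R) (L : (R -> R) -> (R -> R)),
     itv_partition a b X -> lagrange_operator a b X beta L ->
     (op_norm a b L <= M%:E)%E) /\
  (forall (X : n.-tuple R) (L : (R -> R) -> (R -> R)),
     itv_partition a b X -> lagrange_operator a b X beta L ->
     (op_norm a b L <=
       (4 * (3 * beta_max beta - 1) /
         (beta_max beta * (5 - 3 * beta_max beta)))%:E)%E).
Proof.
set K := 4 * (3 * beta_max beta - 1) / _.
suff main (X : n.-tuple R) (L : (R -> R) -> (R -> R)) :
    itv_partition a b X -> lagrange_operator a b X beta L ->
    (op_norm a b L <= K%:E)%E by split => //; exists K.
move=> abX LX.
have beta_le i : beta i <= beta_max beta by exact: le_bigmax.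
have B01 : -1 <= beta_max beta < 0.
  rewrite bigmax_ge_id; apply: bigmax_lt; first lra.
  by move=> i _; case/andP: (beta_itv i).
have [C1 CK CK'] := lagrange_bound_ge B01.
apply: ge_ereal_sup => _ [f [fC f1] <-].
have [Lf_GS2 Lf_f] := LX f fC.
apply/le_unif_norm; apply: (GS2_sup_le n_gt0 beta_itv abX Lf_GS2 Lf_f _ C1 _ CK CK').
  exact/le_unif_norm.
move=> i; rewrite mulrCA ler_peMr// ler_pdivlMr; last by case/andP: B01; lra.
by rewrite mul1r lerD2l lerN2.
Qed.
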